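(* Let $M$ be a mixed graph of order $n$ with underlying graph $M_U$, and let $\mu_1\ge\cdots\ge\mu_n$ be the eigenvalues of $R_H(M)$. Let $\alpha=\min_{1\le i\le n}|\mu_i|$ and $\beta=\max\{\mu_1,|\mu_n|\}$. Then $$\mathcal{E}_{R_H}(M)\ge\frac{2R_{-1}(M_U)+n\alpha\beta}{\alpha+\beta}.$$
   Context: A mixed graph $M$ is obtained from a simple graph $M_U$ by orienting some of its edges; degrees $d_k$ are taken in $M_U$. The Hermitian-Randić matrix $R_H(M)$ has $(k,l)$ entry $\frac{1}{\sqrt{d_kd_l}}$ if $v_kv_l$ is an undirected edge, $\frac{\mathrm{i}}{\sqrt{d_kd_l}}$ if $(v_k,v_l)$ is an arc, $\frac{-\mathrm{i}}{\sqrt{d_kd_l}}$ if $(v_l,v_k)$ is an arc, and $0$ otherwise. $\mathcal{E}_{R_H}(M)=\sum_{i=1}^n|\mu_i|$. $R_{-1}(M_U)=\sum_{v_jv_k\in E(M_U)}\frac{1}{d_jd_k}$ over unordered edges. *)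

(* Defs.v *)
From HB Require Import structures.
From mathcomp Require Import all_boot all_order all_algebra.
From mathcomp Require Import complex.

Set Implicit Arguments.
Unset Strict Implicit.
Unset Printing Implicit Defensive.

Import Order.TTheory GRing.Theory Num.Theory.

Local Open Scope ring_scope.
Local Open Scope complex_scope.

(* [adj] is the underlying simple graph; [is_arc u v] says that the edge uv has
   been oriented from u to v, so the undirected edges are the pairs related by
   [adj] but by [is_arc] in neither direction. *)
Record mixed_graph (n : nat) := MixedGraph {
  adj : rel 'I_n;
  adj_sym : symmetric adj;
  adj_irr : irreflexive adj;
  is_arc : rel 'I_n;
  arc_adj : forall u v, is_arc u v -> adj u v;
  arc_asym : forall u v, is_arc u v -> ~~ is_arc v u
}.

Section MixedGraph.
Variables (R : rcfType) (n : nat) (M : mixed_graph n).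

Definition undirected (u v : 'I_n) : bool :=
  [&& adj M u v, ~~ is_arc M u v & ~~ is_arc M v u].

Definition deg (v : 'I_n) : nat := #|[set u | adj M v u]|.

Definition RH : 'M[R[i]]_n :=
  \matrix_(k, l)
    let w : R := 1 / Num.sqrt ((deg k)%:R * (deg l)%:R) in
    if undirected k l then w%:C
    else if is_arc M k l then 'i%C * w%:C
    else if is_arc M l k then - 'i%C * w%:C
    else 0.

(* The bound j < k counts each unordered edge once. *)
Definition Rm1 : R :=
  \sum_(j < n) \sum_(k < n | (j < k)%N && adj M j k)
    1 / ((deg j)%:R * (deg k)%:R).

End MixedGraph.

(* [mu] lists all the eigenvalues of [A], with algebraic multiplicity and in
   nonincreasing order, all of them being real. *)
Definition ordered_spectrum (R : rcfType) (n : nat)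
    (A : 'M[R[i]]_n) (mu : 'I_n -> R) : Prop :=
  char_poly A = \prod_(i < n) ('X - ((mu i)%:C)%:P)
  /\ forall i j : 'I_n, (i <= j)%N -> mu j <= mu i.

Definition energy (R : rcfType) (n : nat) (mu : 'I_n -> R) : R :=
  \sum_(i < n) `|mu i|.

Definition min_abs (R : rcfType) (n : nat) (mu : 'I_n.+1 -> R) : R :=
  \big[Num.min/`|mu ord0|]_(i < n.+1) `|mu i|.

(* Main.v *)
(* Each eigenvalue satisfies alpha <= |mu_i| <= beta, hence
   0 <= (|mu_i| - alpha) (beta - |mu_i|), that is
   mu_i^2 + alpha beta <= (alpha + beta) |mu_i|. Summing over i gives the bound,
   because the mu_i^2 add up to the trace of RH^2, which is 2 Rm1. When
   alpha + beta = 0 the quotient is 0 by convention. *)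

Require Import Defs.
From mathcomp Require Import all_boot all_order all_algebra.
From mathcomp Require Import complex ring lra.

Set Implicit Arguments.
Unset Strict Implicit.
Unset Printing Implicit Defensive.

Import Order.TTheory GRing.Theory Num.Theory.

Local Open Scope ring_scope.

(** The coefficient of degree [i] survives in degree [i * d]. This allows two polynomials to be
    compared after substituting a power of X. *)
Lemma comp_polyXn_inj (K : idomainType) (d : nat) :
  (0 < d)%N -> injective (fun p : {poly K} => p \Po 'X^d).
Proof.
move=> d0 p q /= e; apply/polyP => i.
have := congr1 (fun r : {poly K} => r`_(i * d)) e.
by rewrite /= !coef_comp_poly_Xn // dvdn_mull // mulnK.
Qed.

(* Substitute X^2 for X: det (X^2 - A^2) = det (X - A) det (X + A). *)
Lemma char_poly_sqr (K : idomainType) (n : nat) (A : 'M[K]_n) (a : 'I_n -> K) :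
  char_poly A = \prod_i ('X - (a i)%:P) ->
  char_poly (A *m A) = \prod_i ('X - (a i ^+ 2)%:P).
Proof.
move=> cA; apply: (@comp_polyXn_inj K 2) => //.
have detXD : \det ('X%:M + map_mx polyC A) = \prod_i ('X + (a i)%:P).
  (* Substituting -X for X in X - A gives -(X + A); the sign (-1)^n of the determinant is then
     spread over the n linear factors. *)
  have -> : 'X%:M + map_mx polyC A =
      -1 *: map_mx (comp_poly (- 'X)) (char_poly_mx A).
    apply/matrixP => i j; rewrite !mxE comp_polyB comp_polyC.
    by case: (i == j); rewrite ?mulr1n ?mulr0n ?comp_polyX ?comp_polyC; ring.
  rewrite detZ det_map_mx -/(char_poly A) cA rmorph_prod /=.
  rewrite -[X in (-1) ^+ X]card_ord -prodr_const -big_split /=.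
  by apply: eq_bigr => i _; rewrite comp_polyB comp_polyX comp_polyC; ring.
rewrite /= [LHS](_ : _ = \det (char_poly_mx A *m ('X%:M + map_mx polyC A))).
  rewrite det_mulmx -/(char_poly A) cA detXD rmorph_prod /= -big_split /=.
  apply: eq_bigr => i _; rewrite comp_polyB comp_polyX comp_polyC rmorphXn /=.
  by ring.
rewrite /char_poly -(det_map_mx (comp_poly 'X^2)); congr (\det _).
have -> : map_mx (comp_poly 'X^2) (char_poly_mx (A *m A)) =
    ('X * 'X)%:M - map_mx polyC (A *m A).
  apply/matrixP => i j; rewrite !mxE comp_polyB comp_polyC -expr2.
  by case: (i == j); rewrite ?mulr1n ?mulr0n ?comp_polyX ?comp_polyC.
rewrite /char_poly_mx map_mxM /=; set B := map_mx polyC A.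
(* The mixed terms cancel because X is a scalar matrix and commutes with [B]. *)
rewrite mulmxDr mulmxBl mulmxBl -scalar_mxM scalar_mxC.
by rewrite addrA subrK.
Qed.

Lemma trace_sqr (K : idomainType) (n : nat) (A : 'M[K]_n) (a : 'I_n -> K) :
  char_poly A = \prod_i ('X - (a i)%:P) -> \tr (A *m A) = \sum_i a i ^+ 2.
Proof.
(* In size 0 there is no subleading coefficient, so this case is separate. *)
move=> /char_poly_sqr cA2; case: n => [|n] in A a cA2 *.
  by rewrite /mxtrace !big_ord0.
apply: oppr_inj; rewrite -char_poly_trace // cA2.
pose s := [seq a i ^+ 2 | i : 'I_n.+1].
have sz : size s = n.+1 by rewrite size_image card_ord.
have := @coefPn_prod_XsubC K s; rewrite sz => /(_ isT).
by rewrite !big_image.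
Qed.

Lemma sum_sym_pairs (V : zmodType) (n : nat) (e : rel 'I_n)
    (f : 'I_n -> 'I_n -> V) :
  symmetric e -> irreflexive e -> (forall i j, f i j = f j i) ->
  \sum_(i < n) \sum_(j < n | e i j) f i j =
  (\sum_(i < n) \sum_(j < n | (i < j)%N && e i j) f i j) *+ 2.
Proof.
(* Exchanging the sums in one of the two copies turns it into the part below the diagonal;
   irreflexivity removes the diagonal. *)
move=> es ei fs; rewrite mulr2n [X in _ = _ + X](exchange_big_dep xpredT) //=.
rewrite -big_split /=; apply: eq_bigr => i _.
rewrite (bigID (fun j : 'I_n => (i < j)%N)) /=; congr (_ + _).
  by apply: eq_bigl => j; rewrite andbC.
apply: eq_big => [j|j _]; last exact: fs.
rewrite es -leqNgt leq_eqVlt andbC; case: eqVneq => //= /ord_inj ->.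
by rewrite ei ltnn.
Qed.

(** Opposite entries carry conjugate phases, 1 and 1 or i and -i, whose product is 1: the
    orientation disappears and only the squared weight remains. *)
Lemma RH_mul_sym_entry (R : rcfType) (n : nat) (M : mixed_graph n) (k l : 'I_n) :
  RH R M k l * RH R M l k =
  if adj M k l then (1 / ((deg M k)%:R * (deg M l)%:R))%:C%C else 0.
Proof.
rewrite !mxE /undirected (adj_sym M l k) [(deg M l)%:R * _]mulrC.
set d := (deg M k)%:R * _; set w := 1 / Num.sqrt d.
have ww : w * w = 1 / d.
  by rewrite /w !div1r -invfM -expr2 sqr_sqrtr // mulr_ge0 ?ler0n.
have wwC : w%:C%C * w%:C%C = (1 / d)%:C%C by rewrite -rmorphM /= ww.
have ii : 'i%C * 'i%C = -1 :> R[i]%C by rewrite -expr2 sqr_i.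
case akl: (is_arc M k l).
  rewrite (negPf (arc_asym akl)) (arc_adj akl) /=.
  by rewrite mulrACA mulrN ii opprK -wwC mul1r.
case alk: (is_arc M l k); last first.
  by case: (adj M k l); rewrite ?mulr0.
rewrite adj_sym (arc_adj alk) /=.
by rewrite mulrACA mulNr ii opprK -wwC mul1r.
Qed.

Lemma sum_sqr_eigenvalues (R : rcfType) (n : nat) (M : mixed_graph n)
    (mu : 'I_n -> R) :
  char_poly (RH R M) = \prod_(i < n) ('X - ((mu i)%:C%C)%:P) ->
  \sum_i mu i ^+ 2 = 2 * Rm1 R M.
Proof.
move=> /trace_sqr tr2; apply: (@complexI R).
rewrite rmorph_sum /= [LHS](eq_bigr (fun i => (mu i)%:C%C ^+ 2)); last first.
  by move=> i _; rewrite rmorphXn.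
rewrite -tr2 mulr_natl -sum_sym_pairs.
- rewrite rmorph_sum; apply: eq_bigr => k _ /=.
  rewrite mxE rmorph_sum /= [RHS]big_mkcond; apply: eq_bigr => l _.
  exact: RH_mul_sym_entry.
- exact: adj_sym.
- exact: adj_irr.
- by move=> i j; rewrite mulrC [in RHS]mulrC [_%:R * _]mulrC.
Qed.

Lemma min_abs_le (R : rcfType) (n : nat) (mu : 'I_n.+1 -> R) (i : 'I_n.+1) :
  min_abs mu <= `|mu i|.
Proof. exact: bigmin_le. Qed.

Lemma min_abs_ge0 (R : rcfType) (n : nat) (mu : 'I_n.+1 -> R) : 0 <= min_abs mu.
Proof. by apply: le_bigmin. Qed.

Theorem theorem3p11 (R : rcfType) (n : nat) (M : mixed_graph n.+1)
    (mu : 'I_n.+1 -> R) (Hmu : ordered_spectrum (RH R M) mu) :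
  let alpha := min_abs mu in
  let beta := Num.max (mu ord0) `|mu ord_max| in
  energy mu >= (2 * Rm1 R M + n.+1%:R * alpha * beta) / (alpha + beta).
Proof.
have [cp mono] := Hmu; cbv zeta.
set alpha := min_abs mu; set beta := Num.max _ _.
(* By monotonicity, mu_i is at most the first eigenvalue, and -mu_i is at most minus the last
   one. *)
have le_beta i : `|mu i| <= beta.
  rewrite ler_norml lerNl !le_max (mono ord0) //= andbT -normrN.
  by rewrite (le_trans _ (ler_norm _)) ?orbT // lerN2 mono // -ltnS.
have alpha0 : 0 <= alpha by exact: min_abs_ge0.
have E0 : 0 <= energy mu by apply: sumr_ge0.
have beta0 : 0 <= beta by exact: le_trans (le_beta ord0).
have [->|nz] := eqVneq (alpha + beta) 0; first by rewrite invr0 mulr0.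
rewrite ler_pdivrMr ?lt_def ?nz ?addr_ge0 //.
rewrite -(sum_sqr_eigenvalues cp) -mulrA mulr_natl.
(* The term n alpha beta becomes a constant sum, so that the inequality can be proved termwise. *)
rewrite -[X in _ *+ X]card_ord -sumr_const.
rewrite -big_split /= /energy mulr_suml; apply: ler_sum => i _.
have : 0 <= (`|mu i| - alpha) * (beta - `|mu i|).
  by rewrite mulr_ge0 // subr_ge0 ?min_abs_le.
(* With mu_i^2 written as the square of its absolute value, the goal is linear in the monomials of
   the expanded product. *)
by rewrite -(real_normK (num_real (mu i))); lra.
Qed.
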